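(* If a finite group $G$ is a pseudo-$M$-group, then $G$ is a pseudo-$M_\pi$-group for every set of primes $\pi$.
   Context: All groups are finite. $\mathrm{Irr}(G)$ is the set of irreducible complex characters of $G$. For $\chi\in\mathrm{Irr}(G)$ put $D(\chi)=\{\psi(1)\mid \psi\in\mathrm{Irr}(H)\text{ for some }H\le G\text{ and }\psi^G=\chi\}$. The group $G$ is a pseudo-$M$-group if $\gcd(D(\chi))=1$ for every $\chi\in\mathrm{Irr}(G)$. By a theorem of Isaacs, pseudo-$M$-groups are solvable, hence $\pi$-separable for every set of primes $\pi$ (a group is $\pi$-separable if it has a normal series each of whose factors is a $\pi$-group or a $\pi'$-group), so the following notions, used for $\pi$-separable groups, apply. Let $\pi$ be a set of primes. $G^o$ is the set of $\pi$-elements of $G$ (elements whose order is a $\pi$-number). The $\pi$-partial characters of $G$ are the restrictions to $G^o$ of (ordinary, possibly reducible, nonzero) complex characters of $G$. $\mathrm{I}_\pi(G)$ is the set of irreducible $\pi$-partial characters, i.e. those that cannot be written as a sum of two $\pi$-partial characters. For $H\le G$ and a $\pi$-partial character $\psi$ of $H$, the induced $\pi$-partial character is $\psi^G(x)=\frac{1}{|H|}\sum_{g\in G,\ gxg^{-1}\in H}\psi(gxg^{-1})$ for $x\in G^o$. For $\varphi\in\mathrm{I}_\pi(G)$ put $S(\varphi)=\{\psi\in\mathrm{I}_\pi(H)\mid H\le G,\ \psi^G=\varphi\}$ (where $H=G$ is allowed). The partial character $\varphi$ is pseudo monomial if $\gcd\{\psi(1)\mid\psi\in S(\varphi)\}=1$.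 The group $G$ is a pseudo-$M_\pi$-group if every $\varphi\in\mathrm{I}_\pi(G)$ is pseudo monomial. *)

(* Defs.v *)
From HB Require Import structures.
From mathcomp Require Import all_boot all_order all_algebra all_fingroup.
From mathcomp Require Import all_solvable all_field all_character.

Set Implicit Arguments.
Unset Strict Implicit.
Unset Printing Implicit Defensive.

Import Order.TTheory GRing.Theory Num.Theory GroupScope.
Local Open Scope ring_scope.

(* By this definition the gcd of the empty set is 0, not 1. *)
Definition is_gcd (D : nat -> Prop) (g : nat) : Prop :=
  (forall n, D n -> (g %| n)%N) /\
  (forall d, (forall n, D n -> (d %| n)%N) -> (d %| g)%N).

Definition inducing_degree (gT : finGroupType) (G : {group gT})
    (chi : 'CF(G)) (n : nat) : Prop :=
  exists (H : {group gT}) (psi : 'CF(H)),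
    [/\ H \subset G, psi \in irr H, 'Ind[G] psi = chi & psi 1%g = n%:R].

Definition pseudo_M_group (gT : finGroupType) (G : {group gT}) : Prop :=
  forall chi : 'CF(G), chi \in irr G -> is_gcd (inducing_degree chi) 1.

Definition pi_elements (gT : finGroupType) (pi : nat_pred) (G : {group gT}) :
    {set gT} :=
  [set x in G | pi.-elt x].

(* A function on G^o = pi_elements pi G is encoded by its extension by zero to
   G, an element of 'CF(G, pi_elements pi G); in particular cfRes_pi chi encodes
   the restriction of chi to G^o (see cfRes_piE). *)
Definition cfRes_pi (gT : finGroupType) (pi : nat_pred) (G : {group gT})
    (chi : 'CF(G)) : 'CF(G) :=
  chi * '1_(pi_elements pi G).

Definition pi_partial_char (gT : finGroupType) (pi : nat_pred)
    (G : {group gT}) (phi : 'CF(G)) : Prop :=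
  exists chi : 'CF(G),
    [/\ chi \is a character, chi != 0 & phi = cfRes_pi pi chi].

Definition irr_pi_partial (gT : finGroupType) (pi : nat_pred)
    (G : {group gT}) (phi : 'CF(G)) : Prop :=
  pi_partial_char pi phi /\
  ~ exists phi1 phi2 : 'CF(G),
      [/\ pi_partial_char pi phi1, pi_partial_char pi phi2
        & phi = phi1 + phi2].

(* On extensions by zero, induction of partial characters is given by the same
   formula as ordinary induction (see cfInd_piE and cfInd_pi_on), hence 'Ind. *)
Definition pi_inducing_degree (gT : finGroupType) (pi : nat_pred)
    (G : {group gT}) (phi : 'CF(G)) (n : nat) : Prop :=
  exists (H : {group gT}) (psi : 'CF(H)),
    [/\ H \subset G, irr_pi_partial pi psi, 'Ind[G] psi = phi
      & psi 1%g = n%:R].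

Definition pseudo_monomial (gT : finGroupType) (pi : nat_pred)
    (G : {group gT}) (phi : 'CF(G)) : Prop :=
  is_gcd (pi_inducing_degree pi phi) 1.

Definition pseudo_Mpi_group (gT : finGroupType) (pi : nat_pred)
    (G : {group gT}) : Prop :=
  forall phi : 'CF(G), irr_pi_partial pi phi -> pseudo_monomial pi phi.

Lemma pi_elements_normal (gT : finGroupType) (pi : nat_pred)
  (G : {group gT}) : pi_elements pi G <| G.
Proof.
apply/andP; split; first by apply/subsetP=> x; rewrite inE => /andP[].
apply/subsetP=> y Gy; rewrite inE; apply/subsetP=> _ /imsetP[x + ->].
by rewrite !inE p_eltJ groupJr.
Qed.

Lemma cfRes_piE (gT : finGroupType) (pi : nat_pred) (G : {group gT})
    (chi : 'CF(G)) x :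
  cfRes_pi pi chi x = if x \in pi_elements pi G then chi x else 0.
Proof.
rewrite cfunE cfuniE ?pi_elements_normal //.
by case: ifP; rewrite (mulr1, mulr0).
Qed.

Lemma pi_partial_char_on (gT : finGroupType) (pi : nat_pred)
    (G : {group gT}) (phi : 'CF(G)) :
  pi_partial_char pi phi -> phi \in 'CF(G, pi_elements pi G).
Proof.
case=> chi [_ _ ->]; apply/cfun_onP=> x /negbTE xGo.
by rewrite cfRes_piE xGo.
Qed.

Lemma cfInd_piE (gT : finGroupType) (G H : {group gT}) (psi : 'CF(H)) x :
    H \subset G ->
  'Ind[G] psi x
    = #|H|%:R^-1 * \sum_(g in G | (x ^ g^-1)%g \in H) psi (x ^ g^-1)%g.
Proof.
move=> sHG; rewrite cfIndE //; congr (_ * _).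
rewrite (reindex_inj invg_inj) [RHS]big_mkcondr /=.
apply: eq_big => [g | g _]; first by rewrite groupV.
by case: ifP => // /negbT /cfun0 ->.
Qed.

Lemma cfInd_pi_on (gT : finGroupType) (pi : nat_pred) (G H : {group gT})
    (psi : 'CF(H)) :
    H \subset G -> pi_partial_char pi psi ->
  'Ind[G] psi \in 'CF(G, pi_elements pi G).
Proof.
move=> sHG /pi_partial_char_on/cfun_onP psi0; apply/cfun_onP=> x xGo.
rewrite cfIndE // big1 ?mulr0 // => g Gg; apply: psi0; apply: contra xGo.
rewrite !inE p_eltJ => /andP[Hxg ->]; rewrite andbT.
by rewrite -(groupJr _ Gg) (subsetP sHG).
Qed.

(* Main.v *)
Require Import Defs.
From mathcomp Require Import all_boot all_order all_algebra all_fingroup.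
From mathcomp Require Import all_solvable all_field all_character.

(** An irreducible pi-partial character phi of G is the restriction of some
    chi in Irr(G), since decomposing a lift of phi decomposes phi.  If psi in
    Irr(H) induces chi, then psi^o induces phi; moreover psi^o is irreducible,
    because a decomposition of psi^o would induce to one of phi.  Hence every
    element of D(chi) is the degree of an element of S(phi), so gcd(D(chi)) = 1
    forces phi to be pseudo monomial. *)

Import GRing.Theory Num.Theory GroupScope.
Local Open Scope ring_scope.

Lemma cfRes_piD (gT : finGroupType) (pi : nat_pred) (G : {group gT})
    (chi1 chi2 : 'CF(G)) :
  cfRes_pi pi (chi1 + chi2) = cfRes_pi pi chi1 + cfRes_pi pi chi2.
Proof. exact: mulrDl. Qed.

Lemma cfRes_pi1 (gT : finGroupType) (pi : nat_pred) (G : {group gT})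
    (chi : 'CF(G)) : cfRes_pi pi chi 1%g = chi 1%g.
Proof. by rewrite cfRes_piE inE group1 p_elt1. Qed.

(** Conjugation preserves element orders, so the terms of the induction formula at [x] are either
    all kept or all cut off, according to whether [x] is a [pi]-element. *)
Lemma cfInd_cfRes_pi (gT : finGroupType) (pi : nat_pred) (G H : {group gT})
    (psi : 'CF(H)) :
  H \subset G -> 'Ind[G] (cfRes_pi pi psi) = cfRes_pi pi ('Ind[G] psi).
Proof.
move=> sHG; apply/cfun_inP=> x Gx.
rewrite cfRes_piE inE Gx /= !cfIndE //.
have psiJ y :
    cfRes_pi pi psi (x ^ y)%g = if pi.-elt x then psi (x ^ y)%g else 0.
  rewrite cfRes_piE inE p_eltJ.
  (* Outside [H] the class function [psi] is 0 by convention, so both branches agree. *)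
  have [//|Hxy] := boolP ((x ^ y)%g \in H).
  by rewrite cfun0 // if_same.
rewrite (eq_bigr _ (fun y _ => psiJ y)).
by case: (pi.-elt x); rewrite // big1_eq mulr0.
Qed.

(** A lift of [psi] induces to a lift of ['Ind[G] psi]. *)
Lemma pi_partial_char_Ind (gT : finGroupType) (pi : nat_pred)
    (G H : {group gT}) (psi : 'CF(H)) :
  H \subset G -> pi_partial_char pi psi -> pi_partial_char pi ('Ind[G] psi).
Proof.
move=> sHG [chi [Nchi nz_chi ->]]; exists ('Ind[G] chi); split.
- exact: cfInd_char.
- by rewrite cfInd_eq0.
- exact: cfInd_cfRes_pi.
Qed.

Lemma irr_pi_partial_lift (gT : finGroupType) (pi : nat_pred)
    (G : {group gT}) (phi : 'CF(G)) :
  irr_pi_partial pi phi -> exists2 chi, chi \in irr G & phi = cfRes_pi pi chi.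
Proof.
case=> [[chi [Nchi nz_chi Dphi]] irr_phi].
have [i /(constt_charP i Nchi)[chi' Nchi' Dchi]] := neq0_has_constt nz_chi.
exists 'chi_i; first exact: mem_irr.
(* Partial characters need nonzero lifts, so [chi'] yields a forbidden summand of [phi] only when
   [chi' != 0]; otherwise [chi] is already irreducible. *)
have [chi'0 | nz_chi'] := eqVneq chi' 0; first by rewrite Dphi Dchi chi'0 addr0.
case: irr_phi; exists (cfRes_pi pi 'chi_i), (cfRes_pi pi chi'); split.
- by exists 'chi_i; rewrite irr_char irr_neq0.
- by exists chi'.
- by rewrite Dphi Dchi cfRes_piD.
Qed.

Lemma irr_pi_partial_cfInd (gT : finGroupType) (pi : nat_pred)
    (G H : {group gT}) (psi : 'CF(H)) :
    H \subset G -> pi_partial_char pi psi -> irr_pi_partial pi ('Ind[G] psi) ->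
  irr_pi_partial pi psi.
Proof.
move=> sHG Npsi [_ irrG]; split=> // -[psi1 [psi2 [Npsi1 Npsi2 Dpsi]]].
case: irrG; exists ('Ind[G] psi1), ('Ind[G] psi2).
by split; rewrite ?Dpsi ?raddfD //; apply: pi_partial_char_Ind.
Qed.

Lemma inducing_degree_cfRes_pi (gT : finGroupType) (pi : nat_pred)
    (G : {group gT}) (chi : 'CF(G)) (n : nat) :
    irr_pi_partial pi (cfRes_pi pi chi) -> inducing_degree chi n ->
  pi_inducing_degree pi (cfRes_pi pi chi) n.
Proof.
move=> irr_chi [H [psi [sHG /irrP[j Dpsi] Dchi psi1]]].
have Ind_psi : 'Ind[G] (cfRes_pi pi psi) = cfRes_pi pi chi.
  by rewrite cfInd_cfRes_pi // Dchi.
exists H, (cfRes_pi pi psi); split; rewrite ?cfRes_pi1 //.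
apply: irr_pi_partial_cfInd sHG _ _; last by rewrite Ind_psi.
by exists psi; rewrite Dpsi irr_char irr_neq0.
Qed.

Theorem theorem3p2 (gT : finGroupType) (G : {group gT}) :
  pseudo_M_group G -> forall pi : nat_pred, pseudo_Mpi_group pi G.
Proof.
move=> pMG pi phi irr_phi.
have [chi irr_chi Dphi] := irr_pi_partial_lift _ _ _ _ irr_phi.
have [_ gcd_chi] := pMG chi irr_chi.
split=> [n _ | d dvd_d]; first exact: dvd1n.
(* A common divisor of the degrees in S(phi) divides every element of D(chi), hence divides 1. *)
apply: gcd_chi => n chi_n; apply: dvd_d.
by rewrite Dphi; apply: inducing_degree_cfRes_pi; rewrite -?Dphi.
Qed.
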